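(* Let $M,N$ be positive integers and let $\varphi\in\mathbb{C}^{MN^2}$ be the Milewski sequence generated by $v\in\mathbb{C}^M$, where $v$ is either the Chu sequence (in which case $M$ is odd) or the P4 sequence of length $M$. Let $a,b,j,N'$ be positive integers such that $\gcd(a,b)=1$, $j\mid MN$, $N'=jN$, and $abN'=MN^2$. Let $\Lambda=K\times L$, where $K=\{0,a,\dots,(bN'-1)a\}$ and $L=\{0,b,\dots,(aN'-1)b\}$ are viewed as subgroups of $\mathbb{Z}/MN^2\mathbb{Z}$. Then $(\varphi,\Lambda)$ is a tight frame for $\mathbb{C}^{MN^2}$ with frame bound $jMN^3$.
   Context: For a positive integer $D$, vectors in $\mathbb{C}^D$ are indexed by $\mathbb{Z}/D\mathbb{Z}$, and $\langle x,y\rangle=\sum_j x[j]\overline{y[j]}$. Translation and modulation on $\mathbb{C}^D$ are $\tau_k(\varphi)[j]=\varphi[j-k]$ and $e_\ell(\varphi)[j]=e^{2\pi i j\ell/D}\varphi[j]$. For $\Lambda\subseteq(\mathbb{Z}/D\mathbb{Z})\times(\mathbb{Z}/D\mathbb{Z})$ (pairs (translation, modulation)), the Gabor system is the family $(\varphi,\Lambda)=\{e_\ell\tau_k\varphi:(k,\ell)\in\Lambda\}$, indexed by $\Lambda$. A finite family $\{v_i\}$ in $\mathbb{C}^D$ is a tight frame with frame bound $A>0$ if $\sum_i|\langle x,v_i\rangle|^2=A\|x\|_2^2$ for all $x\in\mathbb{C}^D$. The Chu sequence of odd length $M$ is $v[k]=e^{\pi i k(k-1)/M}$; the P4 sequence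 of length $M$ (any $M$) is $v[k]=e^{\pi i k(k-M)/M}$. Given $v\in\mathbb{C}^M$, the Milewski sequence $\varphi\in\mathbb{C}^{MN^2}$ is defined by $\varphi[\alpha N+\beta]=v[\alpha]\,e^{2\pi i\alpha\beta/(MN)}$ for $\alpha\in\{0,\dots,MN-1\}$, $\beta\in\{0,\dots,N-1\}$, where the index of $v$ is taken modulo $M$. *)

(* Defs.v *)
From HB Require Import structures.
From mathcomp Require Import all_boot all_order all_algebra.
From mathcomp Require Import all_classical all_reals all_analysis.
From mathcomp Require Import complex.

Set Implicit Arguments.
Unset Strict Implicit.
Unset Printing Implicit Defensive.

Import Order.TTheory GRing.Theory Num.Theory.

Local Open Scope ring_scope.
Local Open Scope complex_scope.

(* MathComp's 'Z_D denotes Z/2 when D = 1, and D = 1 is allowed here (M = N = 1).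
   For D > 0 the ordinals below D.-1.+1 = D carry the additive group structure
   of Z/D.  [inZp : nat -> zmod D] is reduction modulo D, and an element of
   [zmod D] coerces to its representative in {0, ..., D - 1}. *)
Notation zmod D := 'I_D.-1.+1.

Section Gabor.
Variable R : realType.

(* expi t = e^{i t} *)
Definition expi (t : R) : R[i] := cos t +i* sin t.

Definition cvec (D : nat) := {ffun zmod D -> R[i]}.

Definition inner D (x y : cvec D) : R[i] := \sum_j x j * (y j)^*%R.

Definition sqnorm2 D (x : cvec D) : R[i] := \sum_j `|x j| ^+ 2.

Definition translation D (k : zmod D) (phi : cvec D) : cvec D :=
  [ffun j : zmod D => phi (j - k)].

Definition modulation D (l : zmod D) (phi : cvec D) : cvec D :=
  [ffun j : zmod D => expi (2 * pi * (j * l)%N%:R / D%:R) * phi j].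

Definition gabor D (phi : cvec D) (p : zmod D * zmod D) : cvec D :=
  modulation p.2 (translation p.1 phi).

(* The family is (v i), indexed by the elements i of S. *)
Definition tight_frame D (I : finType) (S : {set I}) (v : I -> cvec D) (A : R) :=
  0 < A /\
  forall x : cvec D, \sum_(i in S) `|inner x (v i)| ^+ 2 = A%:C * sqnorm2 x.

Definition chu (M : nat) : cvec M :=
  [ffun k : zmod M => expi (pi * (k%:R * (k%:R - 1)) / M%:R)].

Definition p4 (M : nat) : cvec M :=
  [ffun k : zmod M => expi (pi * (k%:R * (k%:R - M%:R)) / M%:R)].

(* An index n < M * N ^ 2 is uniquely alpha * N + beta with alpha = n %/ N < M * N
   and beta = n %% N < N; see [milewskiE]. *)
Definition milewski (M N : nat) (v : cvec M) : cvec (M * N ^ 2) :=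
  [ffun n : zmod (M * N ^ 2) =>
    v (inZp (n %/ N)) * expi (2 * pi * ((n %/ N) * (n %% N))%N%:R / (M * N)%N%:R)].

Lemma milewskiE (M N : nat) (v : cvec M) (alpha beta : nat) :
    (alpha < M * N)%N -> (beta < N)%N ->
  milewski N v (inZp (alpha * N + beta)) =
    v (inZp alpha) * expi (2 * pi * (alpha * beta)%N%:R / (M * N)%N%:R).
Proof.
move=> ha hb; rewrite ffunE.
have N0 : (0 < N)%N by apply: leq_ltn_trans hb.
have MN0 : (0 < M * N)%N by apply: leq_ltn_trans ha.
have lt : (alpha * N + beta < M * N ^ 2)%N.
  rewrite expnS expn1 mulnA (@leq_trans (alpha.+1 * N)) ?leq_mul2r ?ha ?orbT //.
  by rewrite mulSn addnC ltn_add2r.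
have -> : nat_of_ord (inZp (alpha * N + beta) : zmod (M * N ^ 2))
    = (alpha * N + beta)%N.
  by rewrite /= prednK ?modn_small //; apply: leq_ltn_trans lt.
by rewrite divnMDl // (divn_small hb) addn0 modnMDl (modn_small hb).
Qed.

End Gabor.

Arguments chu {R} M.
Arguments p4 {R} M.

(* {0, c, ..., (n - 1) c} reduced modulo D *)
Definition multiples (D c n : nat) : {set zmod D} := [set inZp (c * s)%N | s : 'I_n].

(* Main.v *)
(* Write D = M N ^ 2.  Both v are quadratic chirps: v[k + s] / v[k] is a constant
   times e^{2 pi i k s / M}.  Hence translating phi by a multiple d of N multiplies
   it, up to a constant, by the character p |-> e^{2 pi i d p / D}.  In the frame
   operator the modulations kill all pairs (n, n + d) with d outside a N' Z, which
   is contained in N Z, and for the remaining d the sum over the translations is a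
   character sum that vanishes unless b N' | d.  Since gcd(a, b) = 1, both
   conditions force d = 0 mod D, so that the frame operator is a scalar. *)
Require Import Defs.
From mathcomp Require Import all_boot all_order all_algebra.
From mathcomp Require Import all_classical all_reals all_analysis.
From mathcomp Require Import complex.
From mathcomp Require Import ring lra.

Set Implicit Arguments.
Unset Strict Implicit.
Unset Printing Implicit Defensive.

Import Order.TTheory GRing.Theory Num.Theory.

Local Open Scope ring_scope.
Local Open Scope complex_scope.

(** * Roots of unity and character sums over cyclic subgroups *)

Section RootsOfUnity.
Variable R : realType.
Implicit Types D k l c n : nat.

Lemma expi0 : expi 0 = 1 :> R[i].
Proof. by rewrite /expi cos0 sin0. Qed.

Lemma expiD (s t : R) : expi (s + t) = expi s * expi t.
Proof.
by rewrite /expi cosD sinD; apply/eqP; rewrite eq_complex /= eqxx addrC eqxx.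
Qed.

Lemma normr_expi (t : R) : `|expi t| = 1.
Proof. by rewrite normc_def /= cos2Dsin2 sqrtr1. Qed.

Lemma expi_2pin n : expi (2 * pi * n%:R) = 1 :> R[i].
Proof.
elim: n => [|n IHn]; first by rewrite mulr0 expi0.
rewrite -(natr1 n) (mulrDr (2 * pi)) expiD IHn mul1r mulr1 mulr_natl.
by rewrite /expi cos2pi sin2pi.
Qed.

Definition omega D k : R[i] := expi (2 * pi * k%:R / D%:R).

Lemma omega0 D : omega D 0 = 1.
Proof. by rewrite /omega mulr0 mul0r expi0. Qed.

Lemma omegaD D k l : omega D (k + l) = omega D k * omega D l.
Proof. by rewrite /omega (natrD _ k) (mulrDr (2 * pi)) mulrDl expiD. Qed.

Lemma omegaX D k n : omega D (k * n) = omega D k ^+ n.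
Proof.
by elim: n => [|n IHn]; rewrite ?muln0 ?omega0 // mulnS omegaD IHn exprS.
Qed.

Lemma omega_conjK D k : omega D k * (omega D k)^*%R = 1.
Proof. by rewrite -normCK normr_expi expr1n. Qed.

Lemma omega_order D n : omega D (D * n) = 1.
Proof.
case: D => [|D]; first by rewrite mul0n omega0.
by rewrite /omega natrM mulrA mulrAC mulfK ?expi_2pin // pnatr_eq0.
Qed.

Lemma omega_mod D k : omega D (k %% D) = omega D k.
Proof. by rewrite [in RHS](divn_eq k D) omegaD mulnC omega_order mul1r. Qed.

Lemma omega_scale D k c : (0 < c)%N -> omega (D * c) (k * c) = omega D k.
Proof.
move=> c0; rewrite /omega !natrM mulrA -mulf_div divff ?mulr1 //.
by rewrite pnatr_eq0 -lt0n.
Qed.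

(** For a residue [0 < r < D], the angle [t = pi r / D] lies in [(0, pi)], so the real part
    [1 - 2 sin^2 t] of [omega D r] is below 1. *)
Lemma omega_eq1 D k : (0 < D)%N -> (omega D k == 1) = (D %| k)%N.
Proof.
move=> D0; apply/idP/idP => [|/dvdnP[q ->]]; last by rewrite mulnC omega_order.
rewrite /dvdn -omega_mod eqn0Ngt; apply: contraTN.
move: (ltn_pmod k D0); move: (k %% D)%N => r rD r0.
set t : R := pi * r%:R / D%:R.
have D0' : (0 : R) < D%:R by rewrite ltr0n.
have t0 : 0 < t by rewrite divr_gt0 ?mulr_gt0 ?pi_gt0 ?ltr0n.
have tpi : t < pi by rewrite ltr_pdivrMr // ltr_pM2l ?pi_gt0 // ltr_nat.
have st : 0 < sin t by rewrite sin_gt0_pi // t0 tpi.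
have -> : omega D r = expi (t *+ 2).
  by rewrite -(mulr_natl t) /omega /t !mulrA.
rewrite eq_complex /= cos_mulr2n cos2sin2 negb_and; apply/orP; left.
by rewrite lt_eqF //; have := exprn_gt0 2 st; lra.
Qed.

Lemma sum_multiples (V : nmodType) D c n (F : zmod D -> V) :
    (c * n)%N = D -> (0 < D)%N ->
  \sum_(k in multiples D c n) F k = \sum_(s < n) F (inZp (c * s)).
Proof.
move=> cnD D0; rewrite big_imset //= => s t _ _ /(congr1 val) /=.
have c0 : (0 < c)%N by move: D0; rewrite -cnD; case: (c).
rewrite prednK // !modn_small -?cnD ?ltn_pmul2l // => /eqP.
by rewrite eqn_pmul2l // => /eqP /val_inj.
Qed.

(** A geometric sum whose ratio [omega D (d * c)] is an [n]-th root of unity, equal to 1 exactly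
    when [n] divides [d]. *)
Lemma sum_multiples_omega D c n d : (c * n)%N = D -> (0 < D)%N ->
  \sum_(k in multiples D c n) omega D (d * k) = if (n %| d)%N then n%:R else 0.
Proof.
move=> cnD D0; rewrite (sum_multiples _ cnD) //.
have c0 : (0 < c)%N by move: D0; rewrite -cnD; case: (c).
have -> : \sum_(s < n) omega D (d * (inZp (c * s) : zmod D))
    = \sum_(s < n) omega D (d * c) ^+ s.
  apply: eq_bigr => s _ /=; rewrite prednK //.
  by rewrite -omega_mod modnMmr omega_mod mulnA omegaX.
case: ifPn => [|ndvd].
  rewrite -(dvdn_pmul2l c0) cnD mulnC -omega_eq1 // => /eqP->.
  by under eq_bigr do rewrite expr1n; rewrite sumr_const card_ord.
have z1 : omega D (d * c) - 1 != 0.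
  by rewrite subr_eq0 omega_eq1 // -cnD mulnC dvdn_pmul2r.
apply: (mulfI z1); rewrite -subrX1 mulr0 -omegaX -mulnA cnD mulnC omega_order.
exact: subrr.
Qed.

Lemma val_zmodD D (p q : zmod D) : (0 < D)%N ->
  (p + q)%R = ((p + q) %% D)%N :> nat.
Proof. by case: D p q. Qed.

Lemma omega_addl D (p q : zmod D) l : (0 < D)%N ->
  omega D ((p + q)%R * l) = omega D (p * l) * omega D (q * l).
Proof.
by move=> D0; rewrite val_zmodD // -omega_mod modnMml omega_mod mulnDl omegaD.
Qed.

End RootsOfUnity.

Lemma sum_setX (V : pzSemiRingType) (I J : finType) (A : {set I}) (B : {set J})
    (F : I -> V) (G : J -> V) :
  \sum_(p in finset.setX A B) F p.1 * G p.2
    = (\sum_(i in A) F i) * (\sum_(j in B) G j).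
Proof.
rewrite big_distrlr pair_big /=.
by apply: eq_bigl => -[i j]; rewrite finset.in_setX.
Qed.

(** * Tight frames from unimodular chirps *)

Section ChirpFrame.
Variable R : realType.

(** Writing the second index of the expanded square as [n + d] makes the modulation enter only
    through the difference [d]. *)
Lemma normr_inner_gabor D (x phi : cvec R D) (p : zmod D * zmod D) : (0 < D)%N ->
  `|inner x (gabor phi p)| ^+ 2 =
  \sum_n \sum_d x n * (x (n + d))^*%R *
    (((phi (n - p.1))^*%R * phi (n + d - p.1)) * omega R D (d * p.2)).
Proof.
move=> D0; rewrite normCK /inner rmorph_sum big_distrl /=.
apply: eq_bigr => n _; rewrite big_distrr (reindex_inj (addrI n)) /=.
apply: eq_bigr => d _; rewrite !ffunE /= -!/(omega R D _).
rewrite (omega_addl R n d p.2 D0) !rmorphM /= !conjCK.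
rewrite -[RHS]mul1r -(omega_conjK R D (n * p.2)); ring.
Qed.

(** As [phi] is unimodular, the bound is the number of pairs, [(b * N') * (a * N') = D * N']. *)
Lemma tight_frame_chirp D a b N' (phi : cvec R D) :
    (a * b * N')%N = D -> (0 < D)%N -> coprime a b ->
    (forall p, `|phi p| = 1) ->
    (forall d : zmod D, (a * N' %| d)%N ->
       exists c, forall p, phi (p + d) = c * omega R D (d * p) * phi p) ->
  tight_frame (finset.setX (multiples D a (b * N')) (multiples D b (a * N')))
    (gabor phi) (D * N')%:R.
Proof.
move=> abN D0 cab phi1 chirp.
have N'0 : (0 < N')%N by move: D0; rewrite -abN; case: (N'); rewrite ?muln0.
have a0 : (0 < a)%N by move: D0; rewrite -abN; case: (a).
split; first by rewrite ltr0n muln_gt0 D0.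
set K := multiples _ _ _; set L := multiples _ _ _.
have aD : (a * (b * N'))%N = D by rewrite mulnA.
have bD : (b * (a * N'))%N = D by rewrite mulnCA.
(* The coefficient of [x n * (x (n + d))^*] in the summed squares; it splits into a translation sum
   times a modulation sum. *)
have corr (n d : zmod D) :
    \sum_(p in finset.setX K L)
      ((phi (n - p.1))^*%R * phi (n + d - p.1)) * omega R D (d * p.2)
    = if d == 0 then (D * N')%:R else 0.
  rewrite (sum_setX K L (fun k => (phi (n - k))^*%R * phi (n + d - k))
    (fun l => omega R D (d * l))) sum_multiples_omega //.
  case: (eqVneq d 0) => [->|d0].
    rewrite dvdn0 (eq_bigr (fun=> 1)) => [|k _].
      rewrite (@sum_multiples _ _ _ (b * N')%N) // sumr_const card_ord -natrM.
      by congr _%:R; rewrite -abN; ring.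
    by rewrite addr0 mulrC -normCK phi1 expr1n.
  case: ifPn => [ad|]; last by rewrite mulr0.
  have [c chirpd] := chirp d ad.
  rewrite (eq_bigr (fun k : zmod D => c * omega R D (d * n) *
      (omega R D (d * k))^*%R)) => [|k _]; last first.
    (* Unimodularity leaves [c] times the character [d] at [n - k]; splitting [n] as [(n - k) + k]
       isolates the dependence on [k]. *)
    rewrite addrAC chirpd mulrC -!mulrA -normCK phi1 expr1n mulr1.
    rewrite -[in RHS](subrK k n) ![(d * _)%N]mulnC (omega_addl _ (n - k)) // -!mulrA.
    by rewrite omega_conjK mulr1.
  rewrite -mulr_sumr -rmorph_sum /= sum_multiples_omega //.
  case: ifPn => [bd|]; last by rewrite rmorph0 mulr0 mul0r.
  case/negP: d0; apply/eqP/val_inj => /=.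
  (* With [d = q * (a * N')], divisibility by [b * N'] gives [b %| q * a], hence [b %| q] by
     coprimality. *)
  have : (D %| d)%N.
    move: ad bd => /dvdnP[q ->].
    rewrite -abN !mulnA !dvdn_pmul2r // [(a * b)%N]mulnC.
    by rewrite dvdn_pmul2r // Gauss_dvdl // coprime_sym.
  have dD : (d < D)%N by rewrite -[D in (_ < D)%N](prednK D0).
  by rewrite /dvdn modn_small // => /eqP.
move=> x.
under eq_bigr => p _ do rewrite normr_inner_gabor //.
rewrite exchange_big /sqnorm2 mulr_sumr; apply: eq_bigr => n _.
rewrite exchange_big (bigD1 0) //= [X in _ + X]big1 => [|d d0].
  by rewrite -mulr_sumr corr eqxx addr0 addr0 -normCK mulrC rmorph_nat.
by rewrite -mulr_sumr corr (negPf d0) mulr0.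
Qed.

End ChirpFrame.

(** * Chirp property of the generating and Milewski sequences *)

Section Milewski.
Variable R : realType.

(** The constant [c] may depend on [s] but not on [k]; natural indices allow [k = n %/ N], which may
    exceed [M]. *)
Definition chirp_ratio M (v : cvec R M) := forall s : nat, exists c, forall k : nat,
  v (inZp (k + s)) = c * omega R M (k * s) * v (inZp k).

(* The parity condition makes the defining formula M-periodic in k. *)
Lemma chirp_ratio_quadratic M e (v : cvec R M) :
    (0 < M)%N -> (e <= M)%N -> ~~ odd (M - e) ->
    (forall k, v k = expi (pi * (k%:R * (k%:R - e%:R)) / M%:R)) ->
  chirp_ratio v.
Proof.
move=> M0 eM even vE.
pose w (k : nat) : R[i] := expi (pi * (k%:R * (k%:R - e%:R)) / M%:R).
have M0' : M%:R != 0 :> R by rewrite pnatr_eq0 -lt0n.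
(* The cross term [2 k s] of the quadratic exponent produces the [omega] factor. *)
have wD k s : w (k + s)%N = w s * omega R M (k * s) * w k.
  rewrite /w /omega -!expiD natrD natrM.
  by congr expi; field.
have wM : w M = 1.
  rewrite /w -natrB // -(odd_double_half (M - e)) (negPf even) add0n.
  rewrite -muln2 natrM -(expi_2pin R ((M - e)./2)).
  by congr expi; field.
(* Periodicity is [wD] at shift [M], where [w M] and the [omega] factor are both 1. *)
have wmod k : w (k %% M)%N = w k.
  rewrite [in RHS](divn_eq k M) addnC.
  elim: (k %/ M)%N => [|q IHq]; first by rewrite mul0n addn0.
  rewrite mulSn addnCA addnC wD wM mul1r mulnC omega_order mul1r.
  exact: IHq.
have vw k : v (inZp k) = w k by rewrite vE /= prednK // -/(w _) wmod.
by move=> s; exists (w s) => k; rewrite !vw wD.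
Qed.

Lemma chirp_ratio_chu M : (0 < M)%N -> odd M -> chirp_ratio (@chu R M).
Proof.
move=> M0 oddM; apply: (@chirp_ratio_quadratic M 1) => // [|k].
  by rewrite oddB // oddM.
by rewrite ffunE.
Qed.

Lemma chirp_ratio_p4 M : (0 < M)%N -> chirp_ratio (@p4 R M).
Proof.
move=> M0; apply: (@chirp_ratio_quadratic M M) => // [|k].
  by rewrite subnn.
by rewrite ffunE.
Qed.

(** Shifting by [d = s * N] adds [s] to the quotient by [N] and fixes the remainder, so [v] and the
    exponential each contribute a character value. *)
Lemma milewski_shift M N (v : cvec R M) : (0 < M)%N -> (0 < N)%N ->
    chirp_ratio v ->
  forall d : zmod (M * N ^ 2), (N %| d)%N ->
  exists c, forall p,
    milewski N v (p + d) = c * omega R (M * N ^ 2) (d * p) * milewski N v p.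
Proof.
move=> M0 N0 chirp d /dvdnP[s ds].
set D := (M * N ^ 2)%N; have D0 : (0 < D)%N by rewrite muln_gt0 M0 expn_gt0 N0.
have DE : D = (M * N * N)%N by rewrite /D expnS expn1 mulnA.
pose w (n : nat) := v (inZp (n %/ N)) * omega R (M * N) ((n %/ N) * (n %% N)).
(* This absorbs the wrap-around of [p + d]: adding [D] to [n] adds [M * N] to the quotient and fixes
   the remainder. *)
have wmod n : w (n %% D)%N = w n.
  rewrite [in RHS](divn_eq n D); move: (n %/ D)%N (n %% D)%N => q r.
  rewrite /w DE mulnA divnMDl // modnMDl mulnDl omegaD.
  rewrite [(q * _ * _)%N]mulnAC [X in omega _ _ X * _]mulnC omega_order mul1r.
  congr (v _ * _); apply/val_inj; rewrite /= prednK //.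
  by rewrite [(M * N)%N]mulnC mulnA modnMDl.
have [c vs] := chirp s.
exists c => p; rewrite !ffunE -!/(omega R _ _) -!/(w _) val_zmodD // wmod ds.
move: (p : nat) => n; rewrite /w addnC divnMDl // modnMDl [(s + _)%N]addnC vs.
(* With [n = alpha N + beta], the fraction [s N n / D] equals [s alpha / M + s beta / (M N)]. *)
have -> : omega R D (s * N * n)
    = omega R M (n %/ N * s) * omega R (M * N) (s * (n %% N)).
  rewrite -(@omega_scale R M _ N) // -omegaD DE mulnAC omega_scale //.
  by congr omega; rewrite {1}(divn_eq n N); ring.
rewrite mulnDl omegaD; ring.
Qed.

Lemma normr_milewski M N (v : cvec R M) p :
  (forall k, `|v k| = 1) -> `|milewski N v p| = 1.
Proof. by move=> v1; rewrite ffunE normrM v1 normr_expi mul1r. Qed.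

End Milewski.

Theorem proposition5p6 (R : realType) (M N : nat) (v : cvec R M)
  (a b j N' : nat) :
  (0 < M)%N -> (0 < N)%N ->
  (v = chu M /\ odd M) \/ v = p4 M ->
  (0 < a)%N -> (0 < b)%N -> (0 < j)%N -> (0 < N')%N ->
  coprime a b ->
  (j %| M * N)%N ->
  N' = (j * N)%N ->
  (a * b * N')%N = (M * N ^ 2)%N ->
  let K := multiples (M * N ^ 2) a (b * N') in
  let L := multiples (M * N ^ 2) b (a * N') in
  tight_frame (finset.setX K L) (gabor (milewski N v)) (j * M * N ^ 3)%N%:R.
Proof.
move=> M0 N0 vE _ _ _ _ cab _ N'E abN /=.
have -> : (j * M * N ^ 3 = M * N ^ 2 * N')%N by rewrite N'E; ring.
have [chirp v1] : chirp_ratio v /\ forall k, `|v k| = 1.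
  case: vE => [[-> oddM]|->]; split.
  - exact: chirp_ratio_chu.
  - by move=> k; rewrite ffunE normr_expi.
  - exact: chirp_ratio_p4.
  - by move=> k; rewrite ffunE normr_expi.
apply: tight_frame_chirp => //.
- by rewrite muln_gt0 M0 expn_gt0 N0.
- by move=> p; exact: normr_milewski.
- move=> d aN'd; apply: milewski_shift => //.
  (* [N' = j * N] makes every multiple of [a * N'] a multiple of [N]. *)
  by apply: dvdn_trans aN'd; rewrite N'E mulnA dvdn_mull.
Qed.
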